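(* Let $G$ be a $\delta$-hyperbolic group and let $L_{\mathrm{geod}}$ be the set of geodesic words. Then $(G,L_{\mathrm{geod}})$ satisfies Property $\mathsf{BP}_\nu$, for the function $\nu(k)=k+2\delta$.
   Context: Let $A$ be a finite alphabet, $\tilde A = A\cup A^{-1}$, $\tilde A^*$ the free monoid on $\tilde A$, and $\mu\colon\tilde A^*\to G$ an epimorphism onto the group $G$ respecting inverses. $|g|$ is the length of a shortest word in $\mu^{-1}(g)$; a word $w$ is geodesic if its length equals $|\mu(w)|$. $G$ and its Cayley graph $\mathrm{Cayley}(G)$ (with respect to $A$) carry the word metric $d(g,h)=|g^{-1}h|$. For $\delta\ge0$, $G$ is $\delta$-hyperbolic if for all $g,h,k\in G$ and all geodesic paths $p(g,h),p(g,k),p(h,k)$ in $\mathrm{Cayley}(G)$ between these points, every vertex of $p(g,h)$ is within distance at most $\delta$ of $p(g,k)\cup p(h,k)$. For a language $L$ of representatives, $H\le G$ is $L$-quasi-convex with constant $k\in\mathbb{N}$ if for every $w\in L\cap\mu^{-1}(H)$, the path in $\mathrm{Cayley}(G)$ starting at $1$ and labeled $w$ stays within distance at most $k$ of $H$. Property $\mathsf{BP}_\nu$ for $(G,L)$, where $\nu$ is a non-decreasing function from $\mathbb{N}$ to the non-negative reals: whenever $H$ and $K$ are $L$-quasi-convex subgroups of $G$ with constant of $L$-quasi-convexity $k$, and $g_1,\dots,g_n\in G$ are such that $K,g_1H,\dots,g_nH$ are pairwise distinct and $K\cap\bigcap_i g_iHg_i^{-1}$ is infinite, there exists $z\in G$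 such that the ball of center $z$ and radius $\nu(k)$ meets $K$ and each of the $g_iH$. *)

(* Defs.v *)
From HB Require Import structures.
From mathcomp Require Import all_boot all_order all_algebra.
From mathcomp Require Import boolp classical_sets functions cardinality reals.

Set Implicit Arguments.
Unset Strict Implicit.
Unset Printing Implicit Defensive.

Import Order.TTheory GRing.Theory Num.Theory.
Local Open Scope classical_set_scope.

(* The alphabet A together with formal inverses: [inl a] is the letter a and
   [inr a] is the letter a^-1. *)
Definition letter (A : finType) : Type := (A + A)%type.
HB.instance Definition _ (A : finType) := Finite.copy (letter A) (A + A)%type.

Definition inv_letter (A : finType) (x : letter A) : letter A :=
  match x with inl a => inr a | inr a => inl a end.

(* The free monoid on [letter A], with the formal inversion of words as its
   involution. *)
Definition word (A : finType) : Type := seq (letter A).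

Section FreeMonoid.
Variable A : finType.

Definition inv_word (w : word A) : word A := rev (map (@inv_letter A) w).

Lemma inv_letterK : involutive (@inv_letter A).
Proof. by case. Qed.

Lemma inv_wordK : involutive inv_word.
Proof. by move=> w; rewrite /inv_word map_rev revK (mapK inv_letterK). Qed.

Lemma inv_word_cat : {morph inv_word : u v / u ++ v >-> v ++ u}.
Proof. by move=> u v; rewrite /inv_word map_cat rev_cat. Qed.

HB.instance Definition _ := Choice.copy (word A) (seq (letter A)).
HB.instance Definition _ := isMonoid.Build (word A) (@catA (letter A))
  (@cat0s (letter A)) (@cats0 (letter A)).
HB.instance Definition _ := hasInv.Build (word A) inv_word.
HB.instance Definition _ := Monoid_isStarMonoid.Build (word A)
  inv_wordK inv_word_cat.

End FreeMonoid.

Record word_epi (A : finType) (G : groupType) := WordEpi {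
  epi_fun :> word A -> G;
  epi_morphism : monoid.monoid_morphism epi_fun;
  epi_inv : {morph epi_fun : w / (w^-1)%g};
  epi_surj : forall g : G, exists w : word A, epi_fun w = g
}.

Section Cayley.
Variables (A : finType) (G : groupType) (mu : word_epi A G).
Local Open Scope group_scope.

Lemma has_word_length (g : G) :
  exists n, `[< exists2 w : word A, mu w = g & size w = n >].
Proof.
by have [w <-] := epi_surj mu g; exists (size w); apply/asboolP; exists w.
Qed.

Definition word_length (g : G) : nat := ex_minn (has_word_length g).

Definition word_dist (g h : G) : nat := word_length (g^-1 * h).

Definition geodesic_words : set (word A) :=
  [set w | size w = word_length (mu w)].

(* Paths in the Cayley graph are given by their origin and their label. *)
Definition cayley_step (g : G) (x : letter A) : G := g * mu [:: x].

Definition path_vertices (g : G) (w : word A) : seq G :=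
  g :: scanl cayley_step g w.

Definition path_end (g : G) (w : word A) : G := foldl cayley_step g w.

Definition geodesic_path (g h : G) (w : word A) : Prop :=
  path_end g w = h /\ size w = word_dist g h.

Definition hyperbolic (R : realType) (delta : R) : Prop :=
  forall (g h k : G) (u v w : word A),
    geodesic_path g h u -> geodesic_path g k v -> geodesic_path h k w ->
    forall x, x \in path_vertices g u ->
      exists2 y, y \in path_vertices g v ++ path_vertices h w &
        ((word_dist x y)%:R <= delta)%R.

Definition is_subgroup (H : set G) : Prop := group_closed [in H].

Definition quasi_convex (L : set (word A)) (k : nat) (H : set G) : Prop :=
  forall w : word A, (L `&` mu @^-1` H) w ->
    forall x, x \in path_vertices 1 w ->
      exists2 h, H h & (word_dist x h <= k)%N.

Definition left_coset (g : G) (H : set G) : set G := [set g * h | h in H].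

Definition conjugate (g : G) (H : set G) : set G := [set g * h * g^-1 | h in H].

Definition word_ball (R : realType) (z : G) (r : R) : set G :=
  [set x | ((word_dist z x)%:R <= r)%R].

Definition BP (R : realType) (nu : nat -> R) (L : set (word A)) : Prop :=
  [/\ forall k, (0 <= nu k)%R,
      {homo nu : m n / (m <= n)%N >-> (m <= n)%R} &
      forall (k : nat) (H K : set G) (n : nat) (g : 'I_n -> G),
        is_subgroup H -> is_subgroup K ->
        quasi_convex L k H -> quasi_convex L k K ->
        (forall i, K <> left_coset (g i) H) ->
        (forall i j, i <> j -> left_coset (g i) H <> left_coset (g j) H) ->
        infinite_set (K `&` \bigcap_(i in [set: 'I_n]) conjugate (g i) H) ->
        exists z : G,
          word_ball z (nu k) `&` K !=set0 /\
          forall i, word_ball z (nu k) `&` left_coset (g i) H !=set0].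

End Cayley.

(* Main.v *)
Require Import Defs.
From mathcomp Require Import all_boot all_order all_algebra.
From mathcomp Require Import boolp classical_sets functions cardinality reals.
From mathcomp Require Import zify lra.

Set Implicit Arguments.
Unset Strict Implicit.
Unset Printing Implicit Defensive.

Import Order.TTheory GRing.Theory Num.Theory.
Local Open Scope ring_scope.

(** Take x in the intersection of K with the conjugates of H.  In the geodesic
    quadrilateral with corners 1, x, x g_i, g_i, the sides [1, g_i] and
    [x, x g_i] have length |g_i|, which does not depend on x, while [1, x] stays
    close to K and [x g_i, g_i] stays close to g_i H.  As the intersection is
    infinite and balls are finite, |x| can be chosen so large that a vertex z
    halfway along [1, x] is far from both short sides for every i; then z is
    2 delta-close to [x g_i, g_i], hence (k + 2 delta)-close to g_i H.  The
    same z is k-close to K. *)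

Section WordMetric.
Variables (A : finType) (G : groupType) (mu : word_epi A G).
Local Open Scope group_scope.

Local Notation len := (word_length mu).
Local Notation dist := (word_dist mu).

Lemma epi_nil : mu [::] = 1.
Proof. exact: (epi_morphism mu).1. Qed.

Lemma epi_cat (u v : word A) : mu (u ++ v) = mu u * mu v.
Proof. exact: (epi_morphism mu).2. Qed.

Lemma word_length_le (w : word A) : (len (mu w) <= size w)%N.
Proof.
rewrite /word_length; case: ex_minnP => n _; apply; apply/asboolP.
by exists w.
Qed.

Lemma word_lengthP (g : G) : exists2 w : word A, mu w = g & size w = len g.
Proof. by rewrite /word_length; case: ex_minnP => n /asboolP. Qed.

Lemma word_length_mul (g h : G) : (len (g * h) <= len g + len h)%N.
Proof.
have [u <- <-] := word_lengthP g; have [v <- <-] := word_lengthP h.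
by rewrite -epi_cat -size_cat word_length_le.
Qed.

Lemma word_length_inv_le (g : G) : (len g^-1 <= len g)%N.
Proof.
have [u <- <-] := word_lengthP g; rewrite -epi_inv.
by rewrite (leq_trans (word_length_le _)) // size_rev size_map.
Qed.

Lemma word_length_inv (g : G) : len g^-1 = len g.
Proof.
by apply/eqP; rewrite eqn_leq word_length_inv_le -{1}[g]invgK
  word_length_inv_le.
Qed.

Lemma word_dist_sym (g h : G) : dist g h = dist h g.
Proof. by rewrite /word_dist -word_length_inv invgM invgK. Qed.

Lemma word_dist_triangle (h g k : G) : (dist g k <= dist g h + dist h k)%N.
Proof.
by rewrite (leq_trans _ (word_length_mul _ _)) // mulgA mulgK.
Qed.

Lemma word_dist_mull (a g h : G) : dist (a * g) (a * h) = dist g h.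
Proof. by rewrite /word_dist invgM -mulgA mulKg. Qed.

Lemma word_dist_mulr (g a : G) : dist g (g * a) = len a.
Proof. by rewrite /word_dist mulKg. Qed.

Lemma path_endE (g : G) (w : word A) : path_end mu g w = g * mu w.
Proof.
rewrite /path_end; elim: w g => [|x w IHw] g /=; first by rewrite epi_nil mulg1.
by rewrite IHw /cayley_step -mulgA -epi_cat.
Qed.

(** Trades the [scanl] recursion for factorisations of the label, in which translating a path or
    cutting it at a vertex is immediate. *)
Lemma path_verticesP (g : G) (w : word A) (x : G) :
  x \in path_vertices mu g w <-> exists u v, w = u ++ v /\ x = g * mu u.
Proof.
rewrite /path_vertices; elim: w g => [|a w IHw] g /=.
  rewrite inE; split=> [/eqP ->|[u [v [/esym/nilP]]]].
    by exists [::], [::]; rewrite epi_nil mulg1.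
  by rewrite /nilp size_cat addn_eq0 => /andP[/nilP -> _] ->;
    rewrite epi_nil mulg1.
rewrite in_cons; split.
  case/predU1P => [->|/IHw[u [v [-> ->]]]].
    by exists [::], (a :: w); rewrite epi_nil mulg1.
  by exists (a :: u), v; split=> //; rewrite -cat1s epi_cat mulgA.
case=> -[|b u] [v []] /=; first by rewrite epi_nil mulg1 => _ ->; rewrite eqxx.
case=> <- wE xE; apply/predU1P; right; apply/IHw; exists u, v; split=> //.
by rewrite xE /cayley_step -mulgA -epi_cat.
Qed.

Lemma path_vertices_mull (a g : G) (w : word A) (x : G) :
  x \in path_vertices mu (a * g) w -> a^-1 * x \in path_vertices mu g w.
Proof.
case/path_verticesP => u [v [-> ->]]; apply/path_verticesP.
by exists u, v; split; rewrite // -mulgA mulKg.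
Qed.

Lemma path_vertices_dist (g : G) (w : word A) (x : G) :
  x \in path_vertices mu g w -> (dist g x <= size w)%N.
Proof.
case/path_verticesP => u [v [-> ->]]; rewrite word_dist_mulr size_cat.
exact: leq_trans (word_length_le u) (leq_addr _ _).
Qed.

Lemma geodesic_path_ex (g h : G) : exists w, geodesic_path mu g h w.
Proof.
have [w muw szw] := word_lengthP (g^-1 * h).
by exists w; rewrite /geodesic_path path_endE muw mulVKg.
Qed.

(** The alphabet is finite, so the dependent sum of tuples of length [i < n] is a finite type; every
    element of the ball is the image of a shortest word, which lies in it. *)
Lemma finite_ball (n : nat) : finite_set [set g : G | (len g < n)%N].
Proof.
pose f (t : {i : 'I_n & (i : nat).-tuple (letter A)}) : G := mu (tagged t).
apply: (@sub_finite_set _ _ (f @` setT)); last by apply: finite_image; exact: finite_finset.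
move=> g /= gn; have [w muw szw] := word_lengthP g.
have wn : (size w < n)%N by rewrite szw.
by exists (Tagged (fun i : 'I_n => (i : nat).-tuple (letter A))
  (in_tuple w : (Ordinal wn : nat).-tuple _)).
Qed.

Lemma infinite_unbounded (I : set G) (n : nat) :
  infinite_set I -> exists2 g, I g & (n <= len g)%N.
Proof.
move=> Iinf; apply: contrapT => Ismall; apply: Iinf.
apply: sub_finite_set (finite_ball n) => g Ig /=.
by rewrite ltnNge; apply/negP => ng; apply: Ismall; exists g.
Qed.

(** Left translation is an isometry: moving the path by [a^-1] makes it start at 1 and end in [H],
    so geodesics between points of a coset of [H] stay close to that coset. *)
Lemma quasi_convex_geodesic (k : nat) (H : set G) (a h : G) (w : word A)
    (x : G) :
  quasi_convex mu (geodesic_words mu) k H -> H h ->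
  geodesic_path mu a (a * h) w -> x \in path_vertices mu a w ->
  exists2 h', H h' & (dist x (a * h') <= k)%N.
Proof.
move=> Hqc Hh [wend wsz] xw.
have muw : mu w = h by apply: (mulgI a); rewrite -path_endE.
have geow : geodesic_words mu w.
  by rewrite /geodesic_words /= wsz word_dist_mulr muw.
have [||h' Hh' xh'] := Hqc w _ (a^-1 * x).
- by split=> //=; rewrite muw.
- by apply: path_vertices_mull; rewrite mulg1.
by exists h' => //; rewrite -(word_dist_mull a) mulVKg in xh'.
Qed.

Section Hyperbolic.
Variables (R : realType) (delta : R).
Hypothesis G_hyp : hyperbolic mu delta.

(** The diagonal from [a] to [c] cuts the quadrilateral into two thin triangles, each costing one
    [delta]. The two distance hypotheses keep [z] away from the sides [[a, d]] and [[b, c]]. *)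
Lemma hyperbolic_quadrilateral (a b c d : G) (u w : word A) (z : G) :
  geodesic_path mu a b u -> geodesic_path mu c d w ->
  z \in path_vertices mu a u ->
  ((dist a d)%:R + 2 * delta < (dist a z)%:R)%R ->
  ((dist b c)%:R + 2 * delta < (dist b z)%:R)%R ->
  (0 <= delta)%R ->
  exists2 y, y \in path_vertices mu c w & ((dist z y)%:R <= 2 * delta)%R.
Proof.
move=> ugeo wgeo zu az bz delta_ge0.
have [v vgeo] := geodesic_path_ex a c.
have [s sgeo] := geodesic_path_ex b c.
have [t tgeo] := geodesic_path_ex a d.
have tri p q r : ((dist p r)%:R <= (dist p q)%:R + (dist q r)%:R :> R)%R.
  by rewrite -natrD ler_nat word_dist_triangle.
have side p q e y : geodesic_path mu p q e -> y \in path_vertices mu p e ->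
    ((dist p y)%:R <= (dist p q)%:R :> R)%R.
  by case=> _ <- /path_vertices_dist; rewrite ler_nat.
have [y yvs zy] := G_hyp ugeo vgeo sgeo zu.
(* If [y] were on [[b, c]], then [z] would be within [dist b c + delta] of [b]. *)
move: yvs; rewrite mem_cat => /orP[yv|/(side _ _ _ _ sgeo) by_le]; last first.
  by exfalso; have := tri b y z; rewrite (word_dist_sym y z); lra.
have cd_sym := (word_dist_sym c d).
have [x xtw yx] := G_hyp vgeo tgeo wgeo yv.
(* If [x] were on [[a, d]], then [z] would be within [dist a d + 2 * delta] of [a]. *)
move: xtw; rewrite mem_cat => /orP[/(side _ _ _ _ tgeo) ax_le|xw].
  exfalso; have := tri a x z; have := tri z y x.
  by rewrite (word_dist_sym x z); lra.
by exists x => //; have := tri z y x; lra.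
Qed.

End Hyperbolic.

End WordMetric.

Theorem proposition6p9 (R : realType) (A : finType) (G : groupType)
    (mu : word_epi A G) (delta : R) (delta_ge0 : 0 <= delta) :
  hyperbolic mu delta ->
  BP mu (fun k : nat => k%:R + 2 * delta) (geodesic_words mu).
Proof.
move=> G_hyp; split=> [k|m n|k H K n g Hsub _ Hqc Kqc _ _].
- by have := ler0n R k; lra.
- by rewrite lerD2r ler_nat.
pose M := (\max_(i < n) word_length mu (g i))%N.
pose N := (M + (Num.bound (2 * delta)))%N.
have gN i : (word_length mu (g i))%:R + 2 * delta < N%:R.
  have : (word_length mu (g i))%:R <= M%:R :> R.
    by rewrite ler_nat; apply: leq_bigmax.
  have := archi_boundP (mulr_ge0 (ler0n R 2) delta_ge0).
  by rewrite /N natrD; lra.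
(* Length at least [2N] leaves room for a vertex at distance at least [N] from both 1 and [x]. *)
case/(infinite_unbounded mu (N + N)%N) => x [Kx conj_x] x_long.
have [u ugeo] := geodesic_path_ex mu 1%g x.
have usz : size u = word_length mu x.
  by rewrite ugeo.2 /word_dist invg1 mul1g.
have mu_u : mu u = x by rewrite -ugeo.1 path_endE mul1g.
pose z := mu (take N u).
have zu : z \in path_vertices mu 1%g u.
  by apply/path_verticesP; exists (take N u), (drop N u);
    rewrite cat_take_drop mul1g.
have x_split : x = (z * mu (drop N u))%g.
  by rewrite -epi_cat cat_take_drop.
(* Both pieces of the geodesic word [u] must be geodesic: if either were shortened, [x] would have
   length below [size u]. *)
have x_le := word_length_mul mu z (mu (drop N u)).
have z_le := word_length_le mu (take N u).
have zx_le := word_length_le mu (drop N u).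
rewrite -x_split in x_le; rewrite size_drop in zx_le.
rewrite size_takel -/z in z_le; last by lia.
have z_far : (N <= word_dist mu 1%g z)%N.
  by rewrite /word_dist invg1 mul1g; lia.
have zx_far : (N <= word_dist mu x z)%N.
  by rewrite word_dist_sym x_split word_dist_mulr; lia.
exists z; split.
  have [|h Kh] := quasi_convex_geodesic (a := 1%g) Kqc Kx _ zu.
    by rewrite mul1g.
  rewrite mul1g => zh; exists h; split=> //=.
  by move: zh; rewrite /word_ball /= -(ler_nat R); lra.
move=> i; have [h Hh def_x] := conj_x i I.
have Hinv : H h^-1%g.
  by apply: set_mem; apply: (group_closedV Hsub); apply: mem_set.
have Hmul h' : H h' -> H (h * h')%g.
  (* [group_closed] provides closure under division, so the product is read as [h / h'^-1]. *)
  move=> Hh'; rewrite -[h']invgK.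
  by apply: set_mem; apply: Hsub.2; rewrite ?(group_closedV Hsub) ?mem_set.
(* Since [x] is the conjugate of [h] by [g i], the corner [x * g i] lies in the coset of [g i]. *)
have xg : (x * g i = g i * h)%g by rewrite -def_x mulgVK.
have [w wgeo] := geodesic_path_ex mu (x * g i)%g (g i).
have [||y yw zy] := hyperbolic_quadrilateral G_hyp ugeo wgeo zu _ _ delta_ge0.
- rewrite /word_dist invg1 mul1g (lt_le_trans (gN i)) // ler_nat.
  by move: z_far; rewrite /word_dist invg1 mul1g.
- by rewrite word_dist_mulr (lt_le_trans (gN i)) // ler_nat.
(* The side from [x * g i] to [g i] is right translation by [h^-1], hence joins two points of that
   coset. *)
have [|h' Hh' yh'] := quasi_convex_geodesic (a := (x * g i)%g) Hqc Hinv _ yw.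
  by rewrite xg mulgK -xg.
exists (g i * (h * h'))%g; split; last by exists (h * h')%g => //; exact: Hmul.
rewrite mulgA -xg /word_ball /=.
have := word_dist_triangle mu y z (x * g i * h')%g.
move: yh'; rewrite -!(ler_nat R) natrD; lra.
Qed.
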